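(* Let $q$ be a power of a prime, let $A,A',B,B',C$ be multiplicative characters of $\mathbb{F}_q^*$ and let $x,y\in\mathbb{F}_q$. If $y\neq 0$, then \begin{align*} F_{3}(A,A';B,\varepsilon;C;x,y)&=-C(-1)\,{}_{2}F_1\left(\begin{matrix}A,B\\ C\end{matrix}\bigg|x\right)+\binom{\overline{A}}{A'\overline{C}}\binom{\overline{B}C}{A'}A'\overline{C}(x)\,\delta(1-y)\\ &\quad+A'(-1)\,\overline{C}(y)\,\overline{A'}C(1-y)\binom{A'B\overline{C}}{A'}\,{}_{2}F_1\left(\begin{matrix}A,B\\ C\overline{A'}\end{matrix}\bigg|-\frac{x(1-y)}{y}\right)\\ &\quad+(q-1)\,\varepsilon(x)\,\overline{C}(y)\,\overline{A'}C(1-y)\,\delta(A'B\overline{C})\,\overline{A}\left(1+\frac{x(1-y)}{y}\right); \end{align*} if $x\neq 0$, then \begin{align*} F_{3}(A,A';\varepsilon,B';C;x,y)&=-C(-1)\,{}_{2}F_1\left(\begin{matrix}A',B'\\ C\end{matrix}\bigg|y\right)+\binom{\overline{A'}}{A\overline{C}}\binom{\overline{B'}C}{A}A\overline{C}(y)\,\delta(1-x)\\ &\quad+A(-1)\,\overline{C}(x)\,\overline{A}C(1-x)\binom{AB'\overline{C}}{A}\,{}_{2}F_1\left(\begin{matrix}A',B'\\ C\overline{A}\end{matrix}\bigg|-\frac{y(1-x)}{x}\right)\\ &\quad+(q-1)\,\varepsilon(y)\,\overline{C}(x)\,\overline{A}C(1-x)\,\delta(AB'\overline{C})\,\overline{A'}\left(1+\frac{y(1-x)}{x}\right).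 \end{align*}
   Context: $\mathbb{F}_q$ is the finite field with $q$ elements and $\widehat{\mathbb{F}}_q$ is the group of (complex-valued) multiplicative characters of $\mathbb{F}_q^*$. Every character $\chi$, including the trivial character $\varepsilon$, is extended to $\mathbb{F}_q$ by $\chi(0)=0$. $\overline{\chi}$ is the inverse of $\chi$; juxtaposition of characters is their product, so that e.g. $A'\overline{C}(x)$ means $(A'\overline{C})(x)$. For characters $\chi,\lambda$ the Jacobi sum is $J(\chi,\lambda)=\sum_{u\in\mathbb{F}_q}\chi(u)\lambda(1-u)$, and the binomial coefficient of characters $A,B$ is $\binom{A}{B}=B(-1)J(A,\overline{B})$ (no factor $1/q$). For characters $A,B,C$ and $x\in\mathbb{F}_q$, ${}_2F_1\left(\begin{matrix}A,B\\ C\end{matrix}\bigg|x\right)=\varepsilon(x)\,BC(-1)\sum_{y\in\mathbb{F}_q}B(y)\,\overline{B}C(1-y)\,\overline{A}(1-xy)$. The finite field Appell series $F_3$ is $$F_{3}(A,A';B,B';C;x,y)=\varepsilon(xy)\,BB'(-1)\sum_{u,v\in\mathbb{F}_q}B(u)\,B'(v)\,C\overline{B}\,\overline{B'}(1-u-v)\,\overline{A}(1-ux)\,\overline{A'}(1-vy).$$ On characters, $\delta(\chi)=1$ if $\chi=\varepsilon$ and $0$ otherwise; on elements of $\mathbb{F}_q$, $\delta(z)=1$ if $z=0$ and $0$ otherwise. *)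

(* Defs.v *)
From HB Require Import structures.
From mathcomp Require Import all_boot all_order all_algebra all_fingroup.
From mathcomp Require Import all_solvable all_field all_character.

Set Implicit Arguments.
Unset Strict Implicit.
Unset Printing Implicit Defensive.

Import Order.TTheory GRing.Theory Num.Theory.
Local Open Scope ring_scope.

(* A multiplicative character of F is a linear character of the finite group
   F^*, i.e. an element chi : mclass F with chi \is a linear_char. Its values
   are complex roots of unity, so MathComp's field algC of algebraic complex
   numbers is large enough to hold all of them. Product, inverse and trivial
   character are *, ^-1 and 1 in the ring of class functions. *)
Notation mclass F := ('CF([set: {unit F}])).

Section FiniteFieldSeries.

Variable F : finFieldType.
Implicit Types (A B C chi lam : mclass F) (x y z : F).

(* Extension by 0; in particular the trivial character also vanishes at 0. *)
Definition ext chi x : algC :=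
  if (insub x : option {unit F}) is Some u then chi u else 0.

Definition jacobi chi lam : algC := \sum_(u : F) ext chi u * ext lam (1 - u).

(* Unlike in Greene's convention, there is no factor 1 / q. *)
Definition chbinom A B : algC := ext B (- 1) * jacobi A B^-1.

Definition hyp2F1 A B C x : algC :=
  ext 1 x * ext (B * C) (- 1) *
  \sum_(y : F) ext B y * ext (B^-1 * C) (1 - y) * ext A^-1 (1 - x * y).

Definition appellF3 A A' B B' C x y : algC :=
  ext 1 (x * y) * ext (B * B') (- 1) *
  \sum_(u : F) \sum_(v : F)
    ext B u * ext B' v * ext (C * B^-1 * B'^-1) (1 - u - v)
    * ext A^-1 (1 - u * x) * ext A'^-1 (1 - v * y).

Definition chdelta chi : algC := (chi == 1)%:R.

Definition eltdelta z : algC := (z == 0)%:R.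

End FiniteFieldSeries.

(* Main.v *)
Require Import Defs.
From HB Require Import structures.
From mathcomp Require Import all_boot all_order all_algebra all_fingroup.
From mathcomp Require Import all_solvable all_field all_character.
From mathcomp Require Import ring.

Set Implicit Arguments.
Unset Strict Implicit.
Unset Printing Implicit Defensive.

Import Order.TTheory GRing.Theory Num.Theory.
Local Open Scope ring_scope.

(** If [x = 0], both sides of the first identity vanish. Otherwise write its sum
    over the [v != 0] as the sum over all v minus the term at [v = 0]. The terms
    at [v = 0], summed over u, contribute [- C(-1) 2F1(A, B; C | x)].

    The full sum over v is a Jacobi sum in disguise: the substitution
    [w = 1 - v y] turns it into a multiple of the sum over w of
    [(C B^-1)(w - t) A'^-1(w)], where [t = 1 - y + u y]. For [t != 0], scaling
    w by t gives a Jacobi sum times the value of [C B^-1 A'^-1] at t; for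
    [t = 0] it is a complete character sum, which vanishes unless
    [A' B C^-1 = 1] ([sum_ext_sub], [sum_ext_inner]). The exceptional value
    [t = 0] is reached at the single point [u = 1 - y^-1], and this gives the
    last term of the identity.

    It remains to sum [B(u) A^-1(1 - u x) (C B^-1 A'^-1)(1 - y + u y)] over u.
    If [y = 1], the last argument is u, the two characters of u merge into
    [C A'^-1], and a second Jacobi sum appears ([sum_ext_outer1]). If
    [y != 1], scaling u by [- (1 - y) / y] turns the last argument into
    [(1 - y) (1 - s)], and the sum is a 2F1 series ([sum_ext_outer]). Its
    coefficient comes out as [J(A'^-1, C B^-1)]; the reflection formula
    [jacobi_reflect] puts it in the form of the stated binomial coefficient.

    The second identity is the first one after the two summation variables
    exchange their roles ([appellF3_swap]). *)

(** * Characters extended by zero *)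

Section Ext.

Variable F : finFieldType.
Implicit Types (chi lam : mclass F) (x y z : F).

Lemma ext_val chi (u : {unit F}) : ext chi (val u) = chi u.
Proof. by rewrite /ext valK. Qed.

Lemma ext0 chi : ext chi 0 = 0.
Proof. by rewrite /ext insubF // unitr0. Qed.

Variant unit_spec : F -> Prop :=
  | UnitZero : unit_spec 0
  | UnitVal (u : {unit F}) : unit_spec (val u).

Lemma unitP x : unit_spec x.
Proof.
have [->|x0] := eqVneq x 0; first exact: UnitZero.
have ux : x \is a GRing.unit by rewrite unitfE.
by rewrite -[x](SubK {unit F} ux); apply: UnitVal.
Qed.

Lemma val_unit_neq0 (u : {unit F}) : val u != 0.
Proof. by rewrite -unitfE; apply: (valP u). Qed.

Lemma ext_mulc chi lam x : ext (chi * lam) x = ext chi x * ext lam x.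
Proof. by case: (unitP x) => [|u]; rewrite ?ext0 ?mul0r // !ext_val cfunE. Qed.

Lemma ext_eps x : ext (1 : mclass F) x = (x != 0)%:R.
Proof.
case: (unitP x) => [|u]; first by rewrite ext0 eqxx.
by rewrite ext_val cfun1E inE val_unit_neq0.
Qed.

Lemma ext_invc chi x : chi \is a linear_char -> ext chi^-1 x = (ext chi x)^-1.
Proof.
move=> lchi; case: (unitP x) => [|u]; first by rewrite !ext0 invr0.
have e : ext chi (val u) * ext chi^-1 (val u) = 1.
  by rewrite -ext_mulc mulrV ?lin_char_unitr // ext_eps val_unit_neq0.
have [z|nz] := eqVneq (ext chi (val u)) 0.
  by move/eqP: e; rewrite z mul0r eq_sym oner_eq0.
by apply: (mulfI nz); rewrite e mulfV.
Qed.

Lemma ext_mul chi x y :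
  chi \is a linear_char -> ext chi (x * y) = ext chi x * ext chi y.
Proof.
move=> lchi; case: (unitP x) => [|u]; first by rewrite mul0r ext0 mul0r.
case: (unitP y) => [|v]; first by rewrite mulr0 ext0 mulr0.
by rewrite -FinRing.val_unitM !ext_val lin_charM ?inE.
Qed.

Lemma ext_one chi : chi \is a linear_char -> ext chi 1 = 1.
Proof. by move=> lchi; rewrite -(FinRing.val_unit1 F) ext_val lin_char1. Qed.

Lemma ext_neq0 chi x : chi \is a linear_char -> x != 0 -> ext chi x != 0.
Proof.
move=> lchi; case: (unitP x) => [|u _]; first by rewrite eqxx.
by rewrite ext_val lin_char_neq0 ?inE.
Qed.

Lemma ext_inv chi x : chi \is a linear_char -> ext chi x^-1 = (ext chi x)^-1.
Proof.
move=> lchi; have [->|x0] := eqVneq x 0; first by rewrite invr0 ext0 invr0.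
apply: (mulfI (ext_neq0 lchi x0)).
by rewrite -ext_mul // !mulfV ?ext_neq0 // ext_one.
Qed.

Lemma ext_N1_sqr chi :
  chi \is a linear_char -> ext chi (- 1) * ext chi (- 1) = 1.
Proof. by move=> lchi; rewrite -ext_mul // mulrNN mulr1 ext_one. Qed.

(** Splitting on the sign leaves rational identities between character values
    at nonzero points. *)
Lemma ext_N1_case chi :
  chi \is a linear_char -> ext chi (- 1) = 1 \/ ext chi (- 1) = - 1.
Proof. by move/ext_N1_sqr => e; apply/pred2P; rewrite -sqrf_eq1 expr2 e. Qed.

(** Orthogonality relation: a nontrivial character takes some value
    [chi u != 1], and substituting [u x] for x multiplies the sum by that value. *)
Lemma sum_ext chi :
  chi \is a linear_char -> \sum_x ext chi x = (#|F|%:R - 1) * chdelta chi.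
Proof.
move=> lchi; rewrite /chdelta; have [->|chi1] := eqVneq chi 1.
  under eq_bigr => x _ do rewrite ext_eps.
  rewrite (bigD1 0) //= eqxx add0r mulr1.
  under eq_bigr => x nz do rewrite nz.
  have F0 : (0 < #|F|)%N by apply/card_gt0P; exists 0.
  by rewrite sumr_const cardC1 -subn1 natrB.
have [u chiu] : exists u : {unit F}, chi u != 1.
  apply/existsP; apply: contraR chi1 => /existsPn /= h.
  apply/eqP/cfunP => u; rewrite cfun1E inE /=.
  by have := h u; rewrite negbK => /eqP.
have : (1 - chi u) * \sum_x ext chi x = 0.
  rewrite mulrBl mul1r big_distrr /= (reindex_inj (mulfI (val_unit_neq0 u))) /=.
  apply/eqP; rewrite subr_eq0; apply/eqP; apply: eq_bigr => x _.
  by rewrite ext_mul // ext_val.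
move/eqP; rewrite mulf_eq0 subr_eq0 eq_sym (negbTE chiu) /= => /eqP ->.
by rewrite mulr0.
Qed.

(** * Jacobi sums *)

Lemma jacobiC chi lam : jacobi chi lam = jacobi lam chi.
Proof.
have inj : injective (fun x : F => 1 - x) by move=> a b /addrI/oppr_inj.
rewrite /jacobi (reindex_inj inj) /=; apply: eq_bigr => x _.
by rewrite mulrC subKr.
Qed.

(** Substitute [u = w / (w - 1)], written as [1 - (1 - w)^-1] so that, with
    [0^-1 = 0], it is an injection of the whole field; the point [w = 1] that
    it fixes contributes zero on both sides. *)
Lemma jacobi_reflect chi lam :
  chi \is a linear_char -> lam \is a linear_char ->
  jacobi chi lam = ext chi (- 1) * jacobi chi (chi * lam)^-1.
Proof.
move=> lchi llam.
have inj : injective (fun w : F => 1 - (1 - w)^-1).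
  by move=> a b /addrI/oppr_inj/invr_inj/addrI/oppr_inj.
rewrite /jacobi big_distrr /= [RHS](reindex_inj inj) /=; apply: eq_bigr => w _.
rewrite subKr ext_invc ?rpredM // ext_mulc !ext_inv // invfM !invrK.
have [->|w1] := eqVneq (1 - w) 0; first by rewrite !ext0 !mulr0.
have -> : 1 - (1 - w)^-1 = - 1 * w / (1 - w) by field.
rewrite !ext_mul // ext_inv //.
have e := ext_N1_sqr lchi; have nz := ext_neq0 lchi w1.
rewrite -[LHS]mul1r -e; field; exact: nz.
Qed.

(** Scaling w by z shows the first term when [z != 0]; when [z = 0] the sum is
    that of the character [chi * lam] over the field. *)
Lemma sum_ext_sub chi lam z :
  chi \is a linear_char -> lam \is a linear_char ->
  \sum_w ext chi (w - z) * ext lam w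
  = ext chi (- 1) * ext (chi * lam) z * jacobi lam chi
    + (#|F|%:R - 1) * chdelta (chi * lam) * (z == 0)%:R.
Proof.
move=> lchi llam; have [->|z0] := eqVneq z 0.
  rewrite ext0 mulr0 mul0r add0r mulr1 -sum_ext ?rpredM //.
  by apply: eq_bigr => w _; rewrite subr0 ext_mulc.
rewrite mulr0 addr0 (reindex_inj (mulfI z0)) /jacobi big_distrr /=.
apply: eq_bigr => w _.
have -> : z * w - z = - 1 * (z * (1 - w)) by ring.
rewrite !ext_mul // ext_mulc; ring.
Qed.

(** * The Appell series *)

Implicit Types A B C : mclass F.

Lemma appellF3_swap A A' B B' C x y :
  appellF3 A A' B B' C x y = appellF3 A' A B' B C y x.
Proof.
rewrite /appellF3 exchange_big /= [y * x]mulrC [B' * B]mulrC; congr (_ * _).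
apply: eq_bigr => v _; apply: eq_bigr => u _.
rewrite [C / B' / B]mulrAC [1 - v - u]addrAC; ring.
Qed.

(** The sum over v in the Appell series, with the point [v = 0] included; the
    factor [z == 0] of [sum_ext_sub] singles out [u = 1 - y^-1]. *)
Lemma sum_ext_inner chi lam u y :
  chi \is a linear_char -> lam \is a linear_char -> y != 0 ->
  \sum_v ext chi (1 - u - v) * ext lam (1 - v * y)
  = (ext chi y)^-1 *
    (ext chi (- 1) * ext (chi * lam) (1 - y + u * y) * jacobi lam chi
     + (#|F|%:R - 1) * chdelta (chi * lam) * (u == 1 - y^-1)%:R).
Proof.
move=> lchi llam y0.
have inj : injective (fun w : F => (1 - w) / y).
  by move=> a b /(mulIf (invr_neq0 y0)) /addrI/oppr_inj.
have -> : (u == 1 - y^-1) = (1 - y + u * y == 0).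
  rewrite -(inj_eq (mulIf y0)) -subr_eq0; congr (_ == 0).
  by field.
rewrite -sum_ext_sub // (reindex_inj inj) big_distrr /=; apply: eq_bigr => w _.
rewrite divfK // subKr.
have -> : 1 - u - (1 - w) / y = (w - (1 - y + u * y)) / y by field.
by rewrite ext_mul // ext_inv // mulrCA mulrA.
Qed.

(** When [y = 1] the factor [1 - y + u y] is u itself, so that the outer sum has
    only the two characters below. *)
Lemma sum_ext_outer1 chi lam x :
  chi \is a linear_char -> lam \is a linear_char -> x != 0 ->
  \sum_u ext chi u * ext lam (1 - u * x) = (ext chi x)^-1 * jacobi chi lam.
Proof.
move=> lchi llam x0; rewrite (reindex_inj (mulIf (invr_neq0 x0))) /jacobi.
rewrite big_distrr /=; apply: eq_bigr => u _.
by rewrite divfK // ext_mul // ext_inv // mulrAC mulrC mulrA.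
Qed.

(** Scaling u by [- (1 - y) / y] makes [1 - y + u y] a multiple of [1 - u]. *)
Lemma sum_ext_outer A B chi x y :
  A \is a linear_char -> B \is a linear_char -> chi \is a linear_char ->
  y != 0 -> 1 - y != 0 ->
  \sum_u ext B u * ext A (1 - u * x) * ext chi (1 - y + u * y)
  = ext B (- 1) * ext B (1 - y) * (ext B y)^-1 * ext chi (1 - y) *
    \sum_s ext B s * ext chi (1 - s)
           * ext A (1 - (- (x * (1 - y) / y)) * s).
Proof.
move=> lA lB lchi y0 y1.
have c0 : - 1 * (1 - y) / y != 0.
  by rewrite !mulf_neq0 ?invr_neq0 ?oppr_eq0 ?oner_eq0.
rewrite (reindex_inj (mulfI c0)) big_distrr /=; apply: eq_bigr => s _.
have -> : 1 - y + - 1 * (1 - y) / y * s * y = (1 - y) * (1 - s) by field.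
have -> : 1 - - 1 * (1 - y) / y * s * x = 1 - (- (x * (1 - y) / y)) * s by ring.
rewrite !(ext_mul _ _ lB) ext_inv // [ext chi _]ext_mul //; ring.
Qed.

Lemma chdeltaV chi : chdelta chi^-1 = chdelta chi.
Proof. by rewrite /chdelta invr_eq1. Qed.

(** Both exceptional contributions are separated here from the generic one: the
    2F1 series comes from [v = 0], the [chdelta] term from [u = 1 - y^-1]. *)
Lemma appellF3_eps_split A A' B C x y :
  A \is a linear_char -> A' \is a linear_char -> B \is a linear_char ->
  C \is a linear_char -> x != 0 -> y != 0 ->
  let chi := C * B^-1 in
  appellF3 A A' B 1 C x y =
  ext B (- 1) * (ext chi y)^-1 *
    (ext chi (- 1) * jacobi A'^-1 chi *
       (\sum_u ext B u * ext A^-1 (1 - u * x)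
                * ext (chi * A'^-1) (1 - y + u * y))
     + (#|F|%:R - 1) * chdelta (chi * A'^-1)
       * (ext B (1 - y^-1) * ext A^-1 (1 - (1 - y^-1) * x)))
  - ext C (- 1) * hyp2F1 A B C x.
Proof.
move=> lA lA' lB lC x0 y0 chi.
have lchi : chi \is a linear_char by rewrite rpredM ?rpredV.
have lA'V : A'^-1 \is a linear_char by rewrite rpredV.
pose f u := ext B u * ext A^-1 (1 - u * x).
have inner u : \sum_v ext B u * ext 1 v * ext (C * B^-1 * 1^-1) (1 - u - v)
    * ext A^-1 (1 - u * x) * ext A'^-1 (1 - v * y)
  = f u * (\sum_v ext chi (1 - u - v) * ext A'^-1 (1 - v * y)
           - ext chi (1 - u)).
  rewrite [in RHS](bigD1 0) //= mul0r !subr0 ext_one // mulr1.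
  rewrite [X in f u * X]addrAC subrr add0r.
  rewrite (bigD1 0) //= ext0 mulr0 !mul0r add0r big_distrr /=.
  apply: eq_bigr => v v0; rewrite ext_eps v0 invr1 !mulr1 /f /chi; ring.
rewrite /appellF3 (eq_bigr _ (fun u _ => inner u)).
under eq_bigr => u _ do
  rewrite sum_ext_inner // mulrBr [f u * (_ * _)]mulrCA mulrDr.
rewrite sumrB -big_distrr big_split /=.
have pick k a : \sum_u f u * (k * (u == a)%:R) = k * f a.
  rewrite (bigD1 a) //= eqxx mulr1 big1 ?addr0 1?mulrC // => u /negbTE ->.
  by rewrite !mulr0.
rewrite pick.
have -> : hyp2F1 A B C x = ext (B * C) (- 1) * \sum_u f u * ext chi (1 - u).
  rewrite /hyp2F1 ext_eps x0 mul1r; congr (_ * _); apply: eq_bigr => u _.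
  by rewrite /f /chi [B^-1 * C]mulrC [x * u]mulrC mulrAC.
rewrite ext_eps mulf_neq0 // mul1r [B * 1]mulr1 [ext (B * C) _]ext_mulc.
have -> : \sum_i f i * (ext chi (-1) * ext (chi * A'^-1) (1 - y + i * y)
              * jacobi A'^-1 chi)
   = ext chi (-1) * jacobi A'^-1 chi *
     \sum_u f u * ext (chi * A'^-1) (1 - y + u * y).
  rewrite big_distrr /=; apply: eq_bigr => u _; ring.
rewrite /f.
by case: (ext_N1_case lC) => ->; ring.
Qed.

Lemma appellF3_eps A A' B C x y :
  A \is a linear_char -> A' \is a linear_char -> B \is a linear_char ->
  C \is a linear_char -> y != 0 ->
  appellF3 A A' B 1 C x y =
     - ext C (- 1) * hyp2F1 A B C x
     + chbinom A^-1 (A' * C^-1) * chbinom (B^-1 * C) A' * ext (A' * C^-1) x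
       * eltdelta (1 - y)
     + ext A' (- 1) * ext C^-1 y * ext (A'^-1 * C) (1 - y)
       * chbinom (A' * B * C^-1) A'
       * hyp2F1 A B (C * A'^-1) (- (x * (1 - y) / y))
     + (#|F|%:R - 1) * ext 1 x * ext C^-1 y * ext (A'^-1 * C) (1 - y)
       * chdelta (A' * B * C^-1) * ext A^-1 (1 + x * (1 - y) / y).
Proof.
move=> lA lA' lB lC y0; have [->|x0] := eqVneq x 0.
  rewrite /appellF3 /hyp2F1 !mul0r oppr0 !ext0; ring.
have lAV : A^-1 \is a linear_char by rewrite rpredV.
have lA'V : A'^-1 \is a linear_char by rewrite rpredV.
have lCB : C * B^-1 \is a linear_char by rewrite rpredM ?rpredV.
have lCBA : C * B^-1 * A'^-1 \is a linear_char by rewrite rpredM.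
rewrite appellF3_eps_split //= addrC mulNr -!addrA; congr (_ + _).
have -> : A' * B * C^-1 = (C * B^-1 * A'^-1)^-1.
  rewrite !invrM ?rpredM ?unitrV ?lin_char_unitr ?rpredM ?rpredV //.
  by rewrite !invrK mulrA.
have -> : 1 + x * (1 - y) / y = 1 - (1 - y^-1) * x by field.
rewrite chdeltaV ext_eps x0 mulr1 mulrDr addrA; congr (_ + _); last first.
  (* The term survives only if [B = A'^-1 * C], which turns the value of B at
     [1 - y^-1] into the stated product of characters of y and [1 - y]. *)
  rewrite /chdelta; case: eqP => [e|_]; last by rewrite !(mulr0, mul0r).
  have eB : A'^-1 * C = B.
    have uB : B \is a GRing.unit by rewrite lin_char_unitr.
    by rewrite mulrC -[LHS](mulrVK uB) [C / A' / B]mulrAC e mul1r.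
  have -> : 1 - y^-1 = - 1 * (1 - y) / y by field.
  rewrite eB !ext_mulc !(ext_invc _ lB) !(ext_invc _ lC).
  rewrite !(ext_mul _ _ lB) ext_inv //.
  have := ext_neq0 lB y0; have := ext_neq0 lC y0.
  by case: (ext_N1_case lB) => -> ? ?; field; apply/andP.
have [y1|y1] := eqVneq (1 - y) 0.
  have {y0 y1} -> : y = 1 by apply/esym/eqP; rewrite -subr_eq0 y1.
  rewrite subrr ext0 /eltdelta eqxx !(mulr0, mul0r) addr0 mulr1 ext_one //.
  have -> : \sum_u ext B u * ext A^-1 (1 - u * x)
                   * ext (C * B^-1 * A'^-1) (0 + u * 1)
          = \sum_u ext (C * A'^-1) u * ext A^-1 (1 - u * x).
    apply: eq_bigr => u _; rewrite add0r mulr1 mulrAC -ext_mulc.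
    by rewrite [C * _]mulrC !mulrA mulrV ?mul1r ?lin_char_unitr.
  rewrite sum_ext_outer1 ?rpredM // /chbinom.
  have -> : (A' * C^-1)^-1 = C * A'^-1.
    by rewrite invrM ?unitrV ?lin_char_unitr // invrK.
  rewrite [jacobi A^-1 _]jacobiC [jacobi (B^-1 * C) _]jacobiC [B^-1 * C]mulrC.
  rewrite !ext_mulc !ext_invc //.
  have := ext_neq0 lC x0; have := ext_neq0 lA' x0.
  by case: (ext_N1_case lC) (ext_N1_case lA') (ext_N1_case lB)
    => -> [] -> [] -> ? ?; field; apply/andP.
rewrite /eltdelta (negbTE y1) mulr0 add0r sum_ext_outer //.
have z0 : - (x * (1 - y) / y) != 0 by rewrite oppr_eq0 !mulf_neq0 ?invr_neq0.
rewrite /hyp2F1 /chbinom ext_eps z0 mul1r.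
have -> : jacobi (C * B^-1 * A'^-1)^-1 A'^-1
          = ext A' (- 1) * jacobi A'^-1 (C * B^-1).
  rewrite [in RHS]jacobi_reflect // [A'^-1 * _]mulrC jacobiC ext_invc //.
  by case: (ext_N1_case lA') => ->; field.
have -> : B^-1 * (C * A'^-1) = C * B^-1 * A'^-1.
  by rewrite mulrA [B^-1 * _]mulrC.
rewrite !ext_mulc !ext_invc //.
have := ext_neq0 lC y0; have := ext_neq0 lB y0.
have := ext_neq0 lB y1; have := ext_neq0 lA' y1.
by case: (ext_N1_case lC) (ext_N1_case lA') (ext_N1_case lB)
    => -> [] -> [] -> ? ? ? ?; field; apply/and4P.
Qed.

End Ext.

Theorem theorem3p2 (F : finFieldType) (A A' B B' C : mclass F)
    (hA : A \is a linear_char) (hA' : A' \is a linear_char)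
    (hB : B \is a linear_char) (hB' : B' \is a linear_char)
    (hC : C \is a linear_char) (x y : F) :
  (y != 0 ->
   appellF3 A A' B 1 C x y =
     - ext C (- 1) * hyp2F1 A B C x
     + chbinom A^-1 (A' * C^-1) * chbinom (B^-1 * C) A' * ext (A' * C^-1) x
       * eltdelta (1 - y)
     + ext A' (- 1) * ext C^-1 y * ext (A'^-1 * C) (1 - y)
       * chbinom (A' * B * C^-1) A'
       * hyp2F1 A B (C * A'^-1) (- (x * (1 - y) / y))
     + (#|F|%:R - 1) * ext 1 x * ext C^-1 y * ext (A'^-1 * C) (1 - y)
       * chdelta (A' * B * C^-1) * ext A^-1 (1 + x * (1 - y) / y))
  /\
  (x != 0 ->
   appellF3 A A' 1 B' C x y =
     - ext C (- 1) * hyp2F1 A' B' C y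
     + chbinom A'^-1 (A * C^-1) * chbinom (B'^-1 * C) A * ext (A * C^-1) y
       * eltdelta (1 - x)
     + ext A (- 1) * ext C^-1 x * ext (A^-1 * C) (1 - x)
       * chbinom (A * B' * C^-1) A
       * hyp2F1 A' B' (C * A^-1) (- (y * (1 - x) / x))
     + (#|F|%:R - 1) * ext 1 y * ext C^-1 x * ext (A^-1 * C) (1 - x)
       * chdelta (A * B' * C^-1) * ext A'^-1 (1 + y * (1 - x) / x)).
Proof.
split=> nz; first exact: appellF3_eps.
by rewrite appellF3_swap; apply: appellF3_eps.
Qed.
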